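(* The three chordal graph embedding problems MinimumFill, MinimumFLOPs and Treewidth are pairwise different, in the sense that no two of the corresponding metrics can be minimized simultaneously in general. That is, for each of the three pairs $\{\mu,\mu'\}$ of distinct metrics chosen from $\{\mathrm{nnz},\mathrm{flop},\omega\}$ there exists a finite simple undirected graph $G$ such that no triangulation $H$ of $G$ minimizes both $\mu$ and $\mu'$ over the set of all triangulations of $G$.
   Context: All graphs are finite, simple and undirected. A triangulation of a graph $G=(V,E)$ is a chordal graph $H=(V,E\cup F)$ with $F\subseteq V\times V$. A perfect elimination ordering (PEO) of a graph $H$ on $n$ vertices is a bijection $\alpha:V\to\{1,\dots,n\}$ such that for each $i$ the neighbors $w$ of $\alpha^{-1}(i)$ in $H$ with $\alpha(w)>i$ form a clique; $H$ is chordal if and only if it has a PEO. For a PEO $\alpha$ of $H$, the elimination degree $d(\alpha^{-1}(i))$ is the number of neighbors $w$ of $\alpha^{-1}(i)$ in $H$ with $\alpha(w)>i$. The multiset of elimination degrees is the same for all PEOs of $H$, so the following quantities depend only on $H$: $$\mathrm{nnz}(H)=\sum_{i=1}^n (d(\alpha^{-1}(i))+1),\quad \mathrm{flop}(H)=\sum_{i=1}^n (d(\alpha^{-1}(i))+1)^2,\quad \omega(H)=\max_{1\le i\le n}(d(\alpha^{-1}(i))+1),$$ where $\alpha$ is any PEO of $H$. MinimumFill, MinimumFLOPs and Treewidth are the problems of minimizing $\mathrm{nnz}(H)$, $\mathrm{flop}(H)$ and $\omega(H)$, respectively, over all triangulations $H$ of a given graph $G$. *)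

(* Defs.v *)
From mathcomp Require Import all_boot.

Set Implicit Arguments.
Unset Strict Implicit.
Unset Printing Implicit Defensive.

Record sgraph (T : finType) := SGraph {
  adj :> rel T;
  adj_sym : symmetric adj;
  adj_irrefl : irreflexive adj
}.

Section Defs.
Variable T : finType.
Implicit Types G H : sgraph T.

(* Every cycle of length at least 4 has a chord, i.e. an edge joining two
   vertices that are not consecutive on the cycle. *)
Definition chordal H : Prop :=
  forall c : seq T, 3 < size c -> ucycle H c ->
  exists x y, [/\ x \in c, y \in c, H x y, y != next c x & x != next c y].

Definition triangulation G H : Prop := subrel G H /\ chordal H.

(* Positions are numbered from 0 instead of 1.  An injection from T into
   'I_#|T| is a bijection. *)
Definition ordering := {ffun T -> 'I_#|T|}.

Definition higher_nbrs H (a : ordering) (v : T) : {set T} :=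
  [set w | H v w & a v < a w].

Definition clique H (A : {set T}) : bool :=
  [forall x in A, forall y in A, (x != y) ==> H x y].

Definition peo H (a : ordering) : bool :=
  injectiveb a && [forall v, clique H (higher_nbrs H a v)].

Definition elim_degree H (a : ordering) (v : T) : nat := #|higher_nbrs H a v|.

(* The three metrics do not depend on the choice of the elimination ordering.
   The value 0 in the None case is a dummy: chordal graphs always have a perfect
   elimination ordering. *)
Definition some_peo H : option ordering := [pick a : ordering | peo H a].

Definition nnz H : nat :=
  if some_peo H is Some a then \sum_(v : T) (elim_degree H a v + 1) else 0.

Definition flop H : nat :=
  if some_peo H is Some a then \sum_(v : T) (elim_degree H a v + 1) ^ 2 else 0.

Definition omega H : nat :=
  if some_peo H is Some a then \max_(v : T) (elim_degree H a v + 1) else 0.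

Definition minimizes (mu : sgraph T -> nat) G H : Prop :=
  triangulation G H /\ forall H', triangulation G H' -> mu H <= mu H'.

End Defs.

(* Main.v *)
Require Import Defs.
From mathcomp Require Import all_boot zify.

Set Implicit Arguments.
Unset Strict Implicit.
Unset Printing Implicit Defensive.

(** Let G be the join of two graphs.  A chordal supergraph of G completes one of
    the two sides to a clique, since otherwise a non-adjacent pair on either
    side would span a chordless 4-cycle ([join_side_clique]).  If both sides are
    chordal but not complete, the minimal triangulations of G are therefore exactly two: complete
    the second side and keep the first, or conversely.  As the three metrics are
    monotone under adding edges, minimizing one of them over all triangulations
    amounts to comparing its values at these two graphs, and two metrics that
    rank the two graphs in opposite strict order have no common minimizer
    ([no_common_minimizer]).

    The sides used here are k isolated vertices, whose non-edges form a
    k-clique, and K_a plus one isolated vertex, whose non-edges form a star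
    with a leaves.  Keeping a side saves its missing edges, all the triangles
    through them, and some clique size.  The clique number strongly favours
    keeping the k isolated vertices, which lowers it by k - 1, against 1 for the
    star.  For k = 3 and a = 4 the star saves more edges (4 against 3) and more
    flops, so nnz and flop disagree with omega.  For k = 4 and a = 7 the star
    saves one more edge (7 against 6), but a triangle containing two of
    the missing edges is saved only once, and 21 pairs of star edges share
    a triangle; so flop prefers to keep the 4 isolated vertices while nnz prefers
    the star.

    Monotonicity rests on an expression of the metrics without an ordering: in a
    perfect elimination ordering every clique is its lowest vertex together with
    a set of higher neighbours, and all such sets are cliques, so there are
    sum_v C(d(v), j) cliques with j + 1 vertices ([card_cliques]).  Hence nnz
    and flop are positive combinations of numbers of cliques, and omega is the
    clique number.  For this to say something about every triangulation, each
    chordal graph must have a perfect elimination ordering; this is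
    Dirac's theorem ([chordal_peo]). *)

(** * Cliques and perfect elimination orderings *)

Section Metrics.
Variable T : finType.
Implicit Types (H : sgraph T) (a : ordering T) (A C D K S : {set T}).

Lemma cliqueP H A :
  reflect {in A &, forall x y, x != y -> H x y} (clique H A).
Proof.
apply: (iffP forall_inP) => [cl x y xA yA xy | cl x xA].
  by move/forall_inP: (cl x xA) => /(_ y yA); rewrite xy.
by apply/forall_inP => y yA; apply/implyP; exact: cl.
Qed.

Lemma cliqueS H A K : A \subset K -> clique H K -> clique H A.
Proof.
move=> /subsetP sAK /cliqueP cl; apply/cliqueP => x y xA yA.
by apply: cl; exact: sAK.
Qed.

Lemma clique_subrel H H' K : subrel H H' -> clique H K -> clique H' K.
Proof.
by move=> sH /cliqueP cl; apply/cliqueP => x y xK yK xy; apply/sH/cl.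
Qed.

Lemma peo_inj H a : peo H a -> injective a.
Proof. by case/andP => /injectiveP. Qed.

Lemma peo_clique H a v : peo H a -> clique H (v |: higher_nbrs H a v).
Proof.
case/andP => _ /forallP/(_ v)/cliqueP cl; apply/cliqueP => x y.
rewrite !in_setU1 => /orP[/eqP-> | xN] /orP[/eqP-> | yN]; rewrite ?eqxx //.
- by move: yN; rewrite inE => /andP[].
- by move: xN; rewrite inE adj_sym => /andP[].
- exact: cl.
Qed.

Definition lowest a K v := (v \in K) && [forall w in K, a v <= a w].

Lemma ex_lowest a K : K != set0 -> exists v, lowest a K v.
Proof.
case/set0Pn => x xK; case: (arg_minnP (fun v => nat_of_ord (a v)) xK) => v vK vmin.
by exists v; rewrite /lowest [_ \in _]vK; apply/forall_inP.
Qed.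

Lemma clique_lowest H a K v : injective a -> clique H K -> lowest a K v ->
  K :\ v \subset higher_nbrs H a v.
Proof.
move=> a_inj /cliqueP cl /andP[vK /forall_inP vmin].
apply/subsetP => w /setD1P[wv wK]; rewrite inE cl 1?eq_sym //=.
rewrite ltn_neqAle vmin // andbT; apply: contra wv => /eqP/val_inj/a_inj->.
exact: eqxx.
Qed.

Definition cliques H j : {set {set T}} := [set K | clique H K & #|K| == j].


Lemma lowest_uniq a K v w : injective a -> lowest a K v -> lowest a K w -> v = w.
Proof.
move=> a_inj /andP[vK /forall_inP vmin] /andP[wK /forall_inP wmin].
by apply/a_inj/val_inj/eqP; rewrite eqn_leq vmin ?wmin.
Qed.

(** The cliques with lowest vertex v are the sets v |: A for A among the higher
    neighbours of v. *)
Lemma card_cliques_lowest H a v j : peo H a ->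
  #|[set K in cliques H j.+1 | lowest a K v]| = 'C(elim_degree H a v, j).
Proof.
move=> pa; set N := higher_nbrs H a v.
have vN : v \notin N by rewrite inE adj_irrefl.
rewrite -cards_draws.
rewrite -(@card_in_imset _ _ (setU [set v])) => [|A B]; last first.
  rewrite !inE => /andP[/subsetP sA _] /andP[/subsetP sB _] eAB.
  have vA : v \notin A by apply: contra vN => /sA.
  have vB : v \notin B by apply: contra vN => /sB.
  by rewrite -(setU1K vA) -(setU1K vB) /= eAB.
apply: eq_card => K; apply/idP/imsetP => [|[A]].
  rewrite !inE => /andP[/andP[clK /eqP szK] lowK].
  have vK : v \in K by case/andP: lowK.
  exists (K :\ v); last by rewrite setD1K.
  rewrite inE (clique_lowest (peo_inj pa) clK lowK) /=.
  by have := cardsD1 v K; rewrite vK szK add1n => -[<-].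
rewrite inE => /andP[sAN /eqP szA] ->{K}.
have vA : v \notin A by apply: contra vN; exact: (subsetP sAN).
rewrite !inE cardsU1 vA szA eqxx andbT.
rewrite (cliqueS (setUS _ sAN) (peo_clique v pa)) /lowest setU11 /=.
apply/forall_inP => w; rewrite in_setU1 => /orP[/eqP->|/(subsetP sAN)] //.
by rewrite inE => /andP[_ /ltnW].
Qed.

(** Counting cliques by their lowest vertex; the left-hand side does not mention
    the ordering, which is why the metrics do not depend on it. *)
Lemma card_cliques H a j : peo H a ->
  #|cliques H j.+1| = \sum_v 'C(elim_degree H a v, j).
Proof.
move=> pa; under eq_bigr => v _ do rewrite -(card_cliques_lowest v j pa).
under eq_bigr => v _ do rewrite -sum1dep_card big_mkcondr.
rewrite exchange_big -sum1_card; apply: eq_bigr => K.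
rewrite inE => /andP[_ /eqP szK].
have [|v lv] := ex_lowest a (K := K); first by rewrite -cards_eq0 szK.
rewrite (bigD1 v) //= lv big1 // => w wv; case: ifP => // lw.
by rewrite (lowest_uniq (peo_inj pa) lw lv) eqxx in wv.
Qed.

Lemma sum_nnz_cliques H a : peo H a ->
  \sum_v (elim_degree H a v + 1) = #|cliques H 1| + #|cliques H 2|.
Proof.
move=> pa; rewrite !(card_cliques _ pa) -big_split; apply: eq_bigr => v _ /=.
by rewrite bin0 bin1 addnC.
Qed.

(** (d + 1) ^ 2 = C(d, 0) + 3 C(d, 1) + 2 C(d, 2). *)
Lemma sum_flop_cliques H a : peo H a ->
  \sum_v (elim_degree H a v + 1) ^ 2 =
  #|cliques H 1| + 3 * #|cliques H 2| + 2 * #|cliques H 3|.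
Proof.
move=> pa; rewrite !(card_cliques _ pa) !big_distrr -!big_split /=.
apply: eq_bigr => v _; have := mul_bin_diag (elim_degree H a v) 1.
rewrite bin0 !bin1; case: (elim_degree H a v) => [|d] /=; first by [].
nia.
Qed.

(** The elimination degrees are bounded by the cliques v |: N(v), with N(v) the
    higher neighbours of v, and every clique lies in the one at its lowest vertex. *)
Lemma max_omega_cliques H a : peo H a ->
  \max_v (elim_degree H a v + 1) = \max_(K : {set T} | clique H K) #|K|.
Proof.
move=> pa; apply/eqP; rewrite eqn_leq; apply/andP; split; apply/bigmax_leqP.
  move=> v _; have vN : v \notin higher_nbrs H a v by rewrite inE adj_irrefl.
  rewrite addnC /elim_degree -[1]/(nat_of_bool true) -vN -cardsU1.
  exact: leq_bigmax_cond (peo_clique v pa).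
move=> K clK; have [->|K0] := eqVneq K set0; first by rewrite cards0.
have [v lv] := ex_lowest a K0; apply: leq_trans (leq_bigmax v).
have /subset_leq_card := clique_lowest (peo_inj pa) clK lv.
by rewrite (cardsD1 v K) addnC; case/andP: lv => -> _; rewrite leq_add2r.
Qed.

(** The two neighbours on a cycle of its lowest vertex are higher, hence adjacent,
    and they are not consecutive once the cycle has length at least 4. *)
Lemma peo_chordal H a : peo H a -> chordal H.
Proof.
move=> pa c szc uc.
have [v lv] : exists v, lowest a [set x in c] v.
  apply: ex_lowest; case: c szc {uc} => // x c _.
  by apply/set0Pn; exists x; rewrite inE mem_head.
have a_inj := peo_inj pa.
have vc : v \in c by case/andP: lv; rewrite inE.
have /andP[_ /forall_inP vmin] := lv.
have high w : w \in c -> H v w -> w \in higher_nbrs H a v.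
  move=> wc Hvw; rewrite inE Hvw ltn_neqAle vmin ?inE // andbT.
  by apply: contraTneq Hvw => /val_inj/a_inj <-; rewrite adj_irrefl.
(* Rotate the cycle to z :: v :: x :: y :: p, where z and x surround v. *)
have zc : prev c v \in c by rewrite mem_prev.
have [i p rc] := rot_to zc.
have uniqc : uniq c by case/andP: uc.
move: zc rc (next_prev uniqc v); set z := prev c v => zc rc nz.
have : ucycle H (z :: p) by rewrite -rc /ucycle rot_cycle rot_uniq.
have mc : c =i z :: p by move=> w; rewrite -rc mem_rot.
have nx w : next c w = next (z :: p) w by rewrite -rc next_rot.
have := size_rot i c; rewrite rc => szp; rewrite -szp in szc.
move: nz; rewrite nx; case: p szc {szp rc} mc nx => [|v0 [|x [|y p]]] //= _ mc nx.
rewrite eqxx => v0v; rewrite {v0}v0v in mc nx *; case/andP=> /and4P[Hzv Hvx _ _].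
rewrite cons_uniq !inE !negb_or => /and3P[/and3P[zv zx /andP[zy _]]].
rewrite !inE !negb_or => /and3P[vx vy _] /andP[/andP[xy _] _].
have xc : x \in c by rewrite mc !inE eqxx !orbT.
have zN : z \in higher_nbrs H a v by apply: high; rewrite // adj_sym.
have xN := high x xc Hvx.
case/andP: pa => _ /forallP/(_ v)/cliqueP/(_ x z xN zN) Hxz.
exists x, z; split=> //; rewrite ?nx /=.
- by rewrite Hxz // eq_sym.
- by rewrite !(eq_sym x) (negPf zx) (negPf vx) eqxx.
- by rewrite eqxx eq_sym.
Qed.

(** * Chordal graphs have perfect elimination orderings *)

Definition ordering_of (r : T -> nat) (r_lt : forall v, r v < #|T|) : ordering T :=
  [ffun v => Ordinal (r_lt v)].

Lemma higher_nbrs_of H r r_lt v :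
  higher_nbrs H (@ordering_of r r_lt) v = [set w | H v w & r v < r w].
Proof. by apply/setP => w; rewrite !inE !ffunE. Qed.

Lemma peo_of H r r_lt : injective r ->
  (forall v, {in [set w | H v w & r v < r w] &, forall x y, x != y -> H x y}) ->
  peo H (@ordering_of r r_lt).
Proof.
move=> r_inj cl; apply/andP; split.
  by apply/injectiveP => v w; rewrite !ffunE => -[/r_inj].
by apply/forallP => v; apply/cliqueP; rewrite higher_nbrs_of; apply: cl.
Qed.

Definition simplicial H A v := clique H [set w in A | H v w].

Definition path_in H D s t (p : seq T) :=
  [&& path H s p, last s p == t & all (mem D) (s :: p)].

(** On a shortest path, a repeated vertex or a chord would allow a shorter one. *)
Lemma induced_path H D s t p0 : path_in H D s t p0 ->
  exists2 p, path_in H D s t p & uniq (s :: p) /\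
    forall p1 x p2 y p3, s :: p = p1 ++ x :: p2 ++ y :: p3 -> H x y -> p2 = [::].
Proof.
move=> pin0.
have exn : exists n, [exists p : n.-tuple T, path_in H D s t p].
  by exists (size p0); apply/existsP; exists (in_tuple p0).
case: (ex_minnP exn) => n /existsP[p pin] min_n.
have short q : path_in H D s t q -> size p <= size q.
  by move=> qin; rewrite size_tuple min_n //; apply/existsP; exists (in_tuple q).
case/and3P: (pin) => pth lst inD.
move: lst; case: (shortenP pth) => q qth uq sub lst.
have qin : path_in H D s t q.
  rewrite /path_in qth lst; apply/allP => w; rewrite inE => ws.
  by apply: (allP inD); rewrite inE; case/orP: ws => [->|/sub->]; rewrite ?orbT.
exists q => //; split=> // p1 x p2 y p3 eq_q Hxy.
have le_qp : size q <= size p by rewrite uniq_leq_size //; case/andP: uq.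
(* Jumping from x to y directly leaves out p2. *)
suff [r rin szr] : exists2 r, path_in H D s t r & size p2 + size r = size q.
  apply/nilP; rewrite /nilp -leqn0 -(leq_add2r (size r)) szr.
  exact: leq_trans le_qp (short r rin).
case/and3P: qin => {}qth /eqP {}lst /allP {}inD.
have {}inD w : w \in p1 ++ [:: x, y & p3] -> w \in D.
  move=> wr; apply: inD; rewrite eq_q; move: wr.
  by rewrite !(mem_cat, inE) => /or4P[] ->; rewrite ?orbT.
case: p1 eq_q inD Hxy => [|s' p1] [<- eq_q] inD Hxy; rewrite eq_q in qth lst *.
  exists (y :: p3); rewrite ?size_cat // /path_in; move: qth lst.
  rewrite cat_path last_cat /= => /and3P[_ _ pth3] lst3.
  have D3 : all (mem D) [:: s, y & p3] by apply/allP => w; exact: inD.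
  by apply/and3P; split; [rewrite /= Hxy | apply/eqP |].
have D1 : all (mem D) (s :: p1 ++ [:: x, y & p3]).
  by apply/allP => w; exact: inD.
exists (p1 ++ [:: x, y & p3]).
  move: qth lst; rewrite cat_path last_cat /= cat_path last_cat /=.
  case/and5P=> pth1 Hx _ _ pth3 lst3; apply/and3P; split.
  - by rewrite cat_path /= pth1 Hx Hxy.
  - by rewrite last_cat; apply/eqP.
  - exact: D1.
by rewrite !size_cat /= size_cat /=; lia.
Qed.

Lemma next_infix (p1 p2 : seq T) x y :
  uniq (p1 ++ [:: x, y & p2]) -> next (p1 ++ [:: x, y & p2]) x = y.
Proof.
by move=> u; rewrite -(next_rot (size p1) u) rot_size_cat /= eqxx.
Qed.

Lemma next_last (p : seq T) x y : uniq (x :: rcons p y) ->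
  next (x :: rcons p y) y = x.
Proof.
move=> u; rewrite -(next_rotr 1 u) -rcons_cons rotr1_rcons /=.
by rewrite eqxx.
Qed.

Lemma mem_split (w : T) q : w \in q -> exists q1 q2, q = q1 ++ w :: q2.
Proof. by case/splitPr=> q1 q2; exists q1, q2. Qed.

(** An induced path from s to t whose interior avoids the neighbours of x closes
    up through x to a cycle that can have no chord, unless it is a triangle. *)
Lemma common_nbrs_adjacent H x D s t p :
    chordal H -> H x s -> H x t -> s != t -> path_in H (s |: (t |: D)) s t p ->
    x \notin D -> {in D, forall w, ~~ H x w} ->
  H s t.
Proof.
move=> chH Hxs Hxt st pin xD avoid.
have [{pin} p pin' [up ind]] := induced_path pin.
case/and3P: pin' => pth /eqP lst /allP inD.
have xs : x != s by apply: contraTneq Hxs => ->; rewrite adj_irrefl.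
have xt : x != t by apply: contraTneq Hxt => ->; rewrite adj_irrefl.
have xp : x \notin s :: p.
  apply/negP => /inD; rewrite !inE (negPf xs) (negPf xt) /=.
  exact/negP.
have uc : uniq (x :: s :: p) by rewrite cons_uniq xp.
case/lastP: p => [|p t'] in pth lst inD up ind xp uc *.
  by rewrite -lst eqxx in st.
rewrite last_rcons in lst; rewrite {t'}lst in pth inD up ind xp uc *.
have [p0 | p_gt0] := posnP (size p).
  by move: pth; rewrite (size0nil p0) /= andbT.
have nbr_x w : w \in s :: rcons p t -> H x w -> (w == s) || (w == t).
  move=> /inD; rewrite !inE; case: (w == s) => //; case: (w == t) => //= wD Hxw.
  by have := avoid w wD; rewrite Hxw.
pose c := x :: s :: rcons p t.
have next_x : next c x = s by rewrite /= eqxx.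
have next_t : next c t = x by apply: (@next_last (s :: p)).
have [||a [b [ac bc Hab]]] := chH c; first by rewrite /= size_rcons.
  by rewrite /ucycle uc /= rcons_path pth last_rcons Hxs adj_sym Hxt.
have chord_at_x w : w \in c -> H x w -> w = next c x \/ x = next c w.
  rewrite inE next_x => /predU1P[->|wp Hxw]; first by rewrite adj_irrefl.
  by case/orP: (nbr_x w wp Hxw) => /eqP->; [left | right; rewrite next_t].
have chord_in_path v w p1 p2 p3 : H v w ->
    s :: rcons p t = p1 ++ v :: p2 ++ w :: p3 -> w = next c v.
  move=> Hvw eq_p; have p20 := ind _ _ _ _ _ eq_p Hvw.
  rewrite p20 /= in eq_p; rewrite /c eq_p -cat_cons next_infix //.
  by rewrite cat_cons -eq_p.
move=> /eqP bna /eqP anb.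
have [ax|ax] := eqVneq a x.
  by rewrite ax in Hab bna anb; case: (chord_at_x b bc Hab).
have [bx|bx] := eqVneq b x.
  by rewrite bx adj_sym in Hab bna anb; case: (chord_at_x a ac Hab).
have {}ac : a \in s :: rcons p t by move: ac; rewrite inE (negPf ax).
have {}bc : b \in s :: rcons p t by move: bc; rewrite inE (negPf bx).
have ba : b != a by apply: contraTneq Hab => ->; rewrite adj_irrefl.
have [p1 [p2 eq_p]] := mem_split ac.
move: bc; rewrite eq_p mem_cat inE (negPf ba) /= => /orP[] /mem_split[q1 [q2 eq_q]].
  case: anb; apply: (chord_in_path b a q1 q2 p2); first by rewrite adj_sym.
  by rewrite eq_p eq_q -catA.
by case: bna; apply: (chord_in_path a b p1 q1 q2); rewrite // eq_p eq_q.
Qed.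

Definition non_nbrs H A x := [set w in A | (w != x) && ~~ H x w].

(** The strengthening of Dirac's lemma that makes the induction work: if x is not
    adjacent to all of A, a simplicial vertex of A can be found away from x.
    Take a component C of the non-neighbours of x.  Its neighbourhood S consists
    of neighbours of x, so it is a clique by [common_nbrs_adjacent].  Vertices of
    C have no neighbours in A outside C :|: S, so it suffices to find in C a
    simplicial vertex of C :|: S, a set that no longer contains x. *)
Lemma simplicial_non_nbr H x A : chordal H -> non_nbrs H A x != set0 -> x \in A ->
  exists2 v, v \in non_nbrs H A x & simplicial H A v.
Proof.
move=> chH; have [m] := ubnP #|A|; elim: m A x => // m IHm A x ltAm /set0Pn[y yN] xA.
pose N := non_nbrs H A x; pose e := [rel u v | [&& u \in N, v \in N & H u v]].
pose C := [set u | connect e y u].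
pose S := [set s in A | H x s && [exists u in C, H s u]].
have CN u : u \in C -> u \in N.
  rewrite inE => /connectP[p]; case/lastP: p => [_ -> //|p w].
  by rewrite rcons_path last_rcons => /andP[_ /and3P[_ wN _]] ->.
have yC : y \in C by rewrite inE connect0.
have CA u : u \in C -> u \in A by move=> /CN; rewrite inE => /andP[].
have nbrC u w : u \in C -> w \in A -> H u w -> w \in C :|: S.
  move=> uC wA Huw; have uN := CN u uC; rewrite in_setU.
  have wx : w != x.
    by apply: contraTneq Huw => ->; move: uN; rewrite adj_sym !inE => /and3P[].
  have [Hxw|nHxw] := boolP (H x w).
    rewrite orbC !inE wA Hxw; apply/orP; left; apply/exists_inP.
    by exists u => //; rewrite adj_sym.
  rewrite inE (connect_trans (y := u)) //; first by move: uC; rewrite inE.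
  by apply: connect1; rewrite /= uN Huw !inE wA wx nHxw.
have clS : clique H S.
  apply/cliqueP => s t; rewrite !inE.
  case/and3P=> sA Hxs /exists_inP[u uC Hsu].
  case/and3P=> tA Hxt /exists_inP[v vC Htv] st.
  have sym_e : connect_sym e.
    by apply: sym_connect_sym => a b /=; rewrite adj_sym andbCA.
  have : connect e u v.
    move: uC vC; rewrite !inE sym_e; exact: connect_trans.
  case/connectP=> p pth lst.
  apply: (@common_nbrs_adjacent H x N s t (u :: rcons p t)) => //.
  - have /andP[pH /allP pN] : path H u p && all (mem N) p.
      elim: p u pth {uC Hsu lst} => //= w p IHp u /andP[/and3P[_ -> ->]] /IHp.
      by [].
    have inD : all (mem (s |: (t |: N))) (s :: u :: rcons p t).
      apply/allP => w; rewrite [X in _ -> X]/= !in_setU !in_set1.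
      rewrite 2!in_cons mem_rcons in_cons.
      by case/or4P=> [->|/eqP->|->|/pN/= ->]; rewrite ?orbT // CN ?orbT.
    by rewrite /path_in inD /= last_rcons eqxx Hsu rcons_path pH -lst adj_sym Htv.
  - by rewrite !inE eqxx andbF.
  - by move=> w; rewrite inE => /and3P[].
have SA s : s \in S -> s \in A by rewrite inE => /andP[].
have ltB : #|C :|: S| < m.
  rewrite -ltnS; apply: leq_trans ltAm; rewrite ltnS; apply/proper_card/properP; split.
    by apply/subsetP => w; rewrite in_setU => /orP[/CA|/SA].
  exists x => //; rewrite in_setU negb_or; apply/andP; split.
    by apply/negP => /CN; rewrite inE eqxx andbF.
  by rewrite inE adj_irrefl andbF.
suff [v vC sv] : exists2 v, v \in C & simplicial H (C :|: S) v.
  exists v; first exact: CN; apply: cliqueS sv; apply/subsetP => w.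
  by rewrite !inE => /andP[wA Hvw]; have := nbrC v w vC wA Hvw; rewrite !inE Hvw andbT.
have IH z : z \in C :|: S -> non_nbrs H (C :|: S) z != set0 ->
    (forall v, v \in S -> v \in non_nbrs H (C :|: S) z -> False) ->
  exists2 v, v \in C & simplicial H (C :|: S) v.
  move=> zB z0 zS; have [v vN sv] := IHm _ z ltB z0 zB.
  exists v => //; have : v \in C :|: S by move: vN; rewrite inE => /andP[].
  by rewrite in_setU => /orP[// | vS]; case: (zS v).
(* If some s in S is not adjacent to all of C :|: S, induct on s: the
   vertex obtained is not in the clique S. *)
have [/exists_inP[s sS s0] | S0] := boolP [exists s in S, non_nbrs H (C :|: S) s != set0].
  apply: (IH s) => //; first by rewrite in_setU sS orbT.
  move=> v vS; rewrite inE => /and3P[_ vs]; case/negP.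
  by move/cliqueP: clS; apply; rewrite // eq_sym.
have univ s w : s \in S -> w \in C :|: S -> w != s -> H s w.
  move=> sS wB ws; apply: contraR S0 => nH; apply/exists_inP; exists s => //.
  by apply/set0Pn; exists w; rewrite inE wB ws.
(* Now S is adjacent to everything, so inducting on any z in C stays in C. *)
have [/exists_inP[z zC z0] | C0] := boolP [exists z in C, non_nbrs H (C :|: S) z != set0].
  apply: (IH z) => //; first by rewrite in_setU zC.
  move=> v vS; rewrite inE => /and3P[_ vz]; case/negP.
  by rewrite adj_sym univ // ?in_setU ?zC // eq_sym.
(* In the remaining case C :|: S is a clique. *)
have all_adj u w : u \in C :|: S -> w \in C :|: S -> w != u -> H u w.
  rewrite in_setU => /orP[uC|uS] wB wu; last exact: univ.
  apply: contraR C0 => nH; apply/exists_inP; exists u => //.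
  by apply/set0Pn; exists w; rewrite inE wB wu.
exists y => //; apply/cliqueP => u w; rewrite 2!inE => /andP[uB _] /andP[wB _] uw.
by apply: all_adj; rewrite 1?eq_sym.
Qed.

Lemma chordal_simplicial H A : chordal H -> A != set0 ->
  exists2 v, v \in A & simplicial H A v.
Proof.
move=> chH A0; have [clA | /forall_inPn[x xA]] := boolP (clique H A).
  have /set0Pn[v vA] := A0; exists v => //; apply: cliqueS clA.
  by apply/subsetP => w; rewrite inE => /andP[].
case/forall_inPn => y yA; rewrite negb_imply => /andP[xy Hxy].
have non_nbrs0 : non_nbrs H A x != set0.
  by apply/set0Pn; exists y; rewrite !inE yA eq_sym xy.
have [v vN sv] := simplicial_non_nbr chH non_nbrs0 xA.
by exists v => //; move: vN; rewrite inE => /andP[].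
Qed.

Lemma elimination_seq H A : chordal H ->
  exists s : seq T, [/\ uniq s, s =i A &
    forall v x y, x \in A -> y \in A -> H v x -> H v y ->
      index v s < index x s -> index v s < index y s -> x != y -> H x y].
Proof.
move=> chH; move: {2}#|A| (erefl #|A|) => n; elim: n A => [|n IHn] A szA.
  by exists [::]; split=> // x; move/eqP: szA; rewrite cards_eq0 => /eqP->; rewrite inE.
have A0 : A != set0 by rewrite -cards_eq0 szA.
have [v vA sv] := chordal_simplicial chH A0.
have szAv : #|A :\ v| = n by move: szA; rewrite (cardsD1 v) vA add1n => -[].
have [s [us es cl]] := IHn _ szAv.
have vs : v \notin s by rewrite es !inE eqxx.
exists (v :: s); split=> [|x|w x y xA yA Hwx Hwy] /=.
- by rewrite vs.
- by rewrite inE es !inE; case: eqVneq => // ->.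
rewrite !(eq_sym v); case: (eqVneq w v) => [ewv _ _ xy|wv].
  by move/cliqueP: sv; apply; rewrite ?inE -?ewv ?xA ?yA.
case: eqVneq => // xv; case: eqVneq => // yv; rewrite !ltnS.
by apply: cl; rewrite // !inE ?xv ?yv.
Qed.

Lemma chordal_peo H : chordal H -> exists a, peo H a.
Proof.
move=> chH; have [s [us es cl]] := elimination_seq [set: T] chH.
have s_mem v : v \in s by rewrite es inE.
have szs : size s = #|T| by rewrite -cardsT -(eq_card es); apply/esym/card_uniqP.
have s_lt v : index v s < #|T| by rewrite -szs index_mem.
exists (ordering_of s_lt); apply: peo_of => [v w|v x y].
  by move/(congr1 (nth v s)); rewrite !nth_index.
by rewrite !inE => /andP[? ?] /andP[? ?]; apply: (cl v x y).
Qed.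

(** * The metrics of chordal graphs, and their monotonicity *)

Lemma nnz_cliques H : chordal H -> nnz H = #|cliques H 1| + #|cliques H 2|.
Proof.
move=> /chordal_peo[a pa]; rewrite /nnz /some_peo.
by case: pickP => [b pb|/(_ a)]; [exact: sum_nnz_cliques | rewrite pa].
Qed.

Lemma flop_cliques H : chordal H ->
  flop H = #|cliques H 1| + 3 * #|cliques H 2| + 2 * #|cliques H 3|.
Proof.
move=> /chordal_peo[a pa]; rewrite /flop /some_peo.
by case: pickP => [b pb|/(_ a)]; [exact: sum_flop_cliques | rewrite pa].
Qed.

Lemma omega_cliques H : chordal H ->
  omega H = \max_(K : {set T} | clique H K) #|K|.
Proof.
move=> /chordal_peo[a pa]; rewrite /omega /some_peo.
by case: pickP => [b pb|/(_ a)]; [exact: max_omega_cliques | rewrite pa].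
Qed.

Lemma nnz_peo H a : peo H a -> nnz H = \sum_v (elim_degree H a v + 1).
Proof.
by move=> pa; rewrite nnz_cliques ?(sum_nnz_cliques pa) //; apply: peo_chordal pa.
Qed.

Lemma flop_peo H a : peo H a -> flop H = \sum_v (elim_degree H a v + 1) ^ 2.
Proof.
by move=> pa; rewrite flop_cliques ?(sum_flop_cliques pa) //; apply: peo_chordal pa.
Qed.

Lemma omega_peo H a : peo H a -> omega H = \max_v (elim_degree H a v + 1).
Proof.
by move=> pa; rewrite omega_cliques ?(max_omega_cliques pa) //; apply: peo_chordal pa.
Qed.

Lemma leq_cliques H H' j : subrel H H' -> #|cliques H j| <= #|cliques H' j|.
Proof.
move=> sH; apply/subset_leq_card/subsetP => K; rewrite !inE => /andP[clK ->].
by rewrite (clique_subrel sH clK).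
Qed.

Definition monotone (mu : sgraph T -> nat) := forall H H',
  chordal H -> chordal H' -> subrel H H' -> mu H <= mu H'.

Lemma nnz_monotone : monotone (@nnz T).
Proof.
by move=> H H' cH cH' sH; rewrite !nnz_cliques // leq_add ?leq_cliques.
Qed.

Lemma flop_monotone : monotone (@flop T).
Proof.
by move=> H H' cH cH' sH; rewrite !flop_cliques // !leq_add ?leq_mul ?leq_cliques.
Qed.

Lemma omega_monotone : monotone (@omega T).
Proof.
move=> H H' cH cH' sH; rewrite !omega_cliques //; apply/bigmax_leqP => K clK.
exact: leq_bigmax_cond (clique_subrel sH clK).
Qed.

(** * Two minimal triangulations *)

(** A minimizer of both metrics would contain H1 or H2: the first contradicts
    mu H2 < mu H1, the second mu' H1 < mu' H2. *)
Lemma no_common_minimizer (mu mu' : sgraph T -> nat) (G H1 H2 : sgraph T) :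
    monotone mu -> monotone mu' -> triangulation G H1 -> triangulation G H2 ->
    (forall H, triangulation G H -> subrel H1 H \/ subrel H2 H) ->
    mu H2 < mu H1 -> mu' H1 < mu' H2 ->
  ~ exists H, minimizes mu G H /\ minimizes mu' G H.
Proof.
move=> mon mon' t1 t2 dich lt_mu lt_mu' [H [[tH min] [_ min']]].
have [cH c1 c2] : [/\ chordal H, chordal H1 & chordal H2].
  by split; [case: tH | case: t1 | case: t2].
case: (dich H tH) => [/(mon _ _ c1 cH) le1 | /(mon' _ _ c2 cH) le2].
  by have := leq_trans le1 (min _ t2); rewrite leqNgt lt_mu.
by have := leq_trans le2 (min' _ t1); rewrite leqNgt lt_mu'.
Qed.

(** Non-adjacent x, y in A and z, t outside A give the chordless cycle x z y t. *)
Lemma join_side_clique H A :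
    chordal H -> (forall v w, v \in A -> w \notin A -> H v w) ->
  clique H A \/ clique H (~: A).
Proof.
move=> chH join; have [|/forall_inPn[x xA]] := boolP (clique H A); first by left.
case/forall_inPn => y yA; rewrite negb_imply => /andP[xy nxy].
have [|/forall_inPn[z zA]] := boolP (clique H (~: A)); first by right.
case/forall_inPn => t tA; rewrite negb_imply => /andP[zt nzt].
move: zA tA; rewrite !inE => zA tA.
have ne v w : v \in A -> w \notin A -> v != w.
  by move=> vA; apply: contraNneq => <-.
have [||p [q [pc qc Hpq qp pq]]] := chH [:: x; z; y; t] => //.
  rewrite /ucycle /= !inE !negb_or ne // xy ne // (eq_sym z) ne // zt ne //.
  by rewrite join // adj_sym join // join // adj_sym join.
have nx : next [:: x; z; y; t] x = z by rewrite /= eqxx.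
have nz : next [:: x; z; y; t] z = y.
  by rewrite /= !(eq_sym z) eqxx (negPf (ne _ _ xA zA)).
have ny : next [:: x; z; y; t] y = t.
  by rewrite /= eq_sym (negPf xy) (negPf (ne _ _ yA zA)) eqxx.
have nt : next [:: x; z; y; t] t = x.
  rewrite /= eqxx !(eq_sym t) (negPf (ne _ _ xA tA)) (negPf (ne _ _ yA tA)).
  by rewrite (negPf zt).
have nyx := nxy; rewrite adj_sym in nyx.
have ntz := nzt; rewrite adj_sym in ntz.
move: qp pq Hpq; have := qc; have := pc; rewrite !inE.
by case/or4P=> /eqP->; case/or4P=> /eqP->; rewrite ?nx ?ny ?nz ?nt ?eqxx //;
  rewrite ?adj_irrefl ?(negPf nxy) ?(negPf nyx) ?(negPf nzt) ?(negPf ntz).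
Qed.
End Metrics.

(** * The join of isolated vertices with a clique plus an isolated vertex *)

(** The graphs below are nearly complete, so they are described by their missing
    edges; miss need contain only one orientation of each. *)
Definition without n (miss : rel nat) : rel 'I_n :=
  fun v w => (v != w) && ~~ (miss v w || miss w v).

Lemma without_sym n miss : symmetric (@without n miss).
Proof. by move=> v w; rewrite /without eq_sym orbC. Qed.

Lemma without_irrefl n miss : irreflexive (@without n miss).
Proof. by move=> v; rewrite /without eqxx. Qed.

Definition co_graph n miss : sgraph 'I_n :=
  SGraph (@without_sym n miss) (@without_irrefl n miss).

(** The vertices below k are the isolated vertices of the first side, those from
    k to k + a - 1 are the clique of the second side, and k + a is its isolated
    vertex, the centre of the missing star. *)
Definition indep k : rel nat := fun i j => (i < k) && (j < k).
Definition star k a : rel nat := fun i j => (i == k + a) && (k <= j).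

Definition order_of k a := k + a.+1.

Definition join_graph k a := co_graph (order_of k a) (relU (indep k) (star k a)).
Definition keep_indep k a := co_graph (order_of k a) (indep k).
Definition keep_star k a := co_graph (order_of k a) (star k a).

Lemma ord_lt n (v : 'I_n) : v < #|'I_n|.
Proof. by rewrite card_ord. Qed.

Lemma rev_lt n (v : 'I_n) : n - v.+1 < #|'I_n|.
Proof. by rewrite card_ord; have := ltn_ord v; lia. Qed.

(** Eliminate the isolated vertices first: the other vertices form a clique. *)
Lemma keep_indep_peo k a : peo (keep_indep k a) (ordering_of (@ord_lt _)).
Proof.
apply: peo_of => [|v x y]; first exact: val_inj.
rewrite !inE /= /without /indep => /andP[/andP[_ vx] lvx] /andP[/andP[_ vy] lvy] ->.
lia.
Qed.

(** The decreasing order starts with the centre of the star, whose neighbours are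
    the vertices below k; the rest is a clique. *)
Lemma keep_star_peo k a : peo (keep_star k a) (ordering_of (@rev_lt _)).
Proof.
apply: peo_of => [v w e|v x y].
  by apply/val_inj => /=; have := ltn_ord v; have := ltn_ord w; lia.
have := ltn_ord v; have := ltn_ord x; have := ltn_ord y.
rewrite !inE /= /without /star /order_of => ? ? ?.
move=> /andP[/andP[_ vx] lvx] /andP[/andP[_ vy] lvy] ->.
lia.
Qed.

Lemma triangulation_dichotomy k a H : triangulation (join_graph k a) H ->
  subrel (keep_indep k a) H \/ subrel (keep_star k a) H.
Proof.
case=> sH chH; pose A := [set v : 'I_(order_of k a) | v < k].
have join v w : v \in A -> w \notin A -> H v w.
  rewrite !inE -leqNgt => vk kw; apply: sH; rewrite /= /without /indep /star /=.
  apply/andP; split; last by lia.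
  by apply/eqP => vw; rewrite vw in vk; lia.
case: (join_side_clique chH join) => /cliqueP cl; [right | left] => v w /andP[vw nmiss].
  have [vA|vA] := boolP (v \in A); have [wA|wA] := boolP (w \in A).
  - exact: cl.
  - exact: join.
  - by rewrite adj_sym join.
  apply: sH; rewrite /= /without vw /=; move: vA wA; rewrite !inE /indep; lia.
have [vA|vA] := boolP (v \in A); have [wA|wA] := boolP (w \in A).
- by move: vA wA nmiss; rewrite !inE /indep => -> ->.
- exact: join.
- by rewrite adj_sym join.
by apply: cl; rewrite ?in_setC.
Qed.

Lemma triangulation_keep_indep k a : triangulation (join_graph k a) (keep_indep k a).
Proof.
split; last exact: peo_chordal (keep_indep_peo k a).
by move=> v w /=; rewrite /without /= => /andP[->]; lia.
Qed.

Lemma triangulation_keep_star k a : triangulation (join_graph k a) (keep_star k a).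
Proof.
split; last exact: peo_chordal (keep_star_peo k a).
by move=> v w /=; rewrite /without /= => /andP[->]; lia.
Qed.

(** * Evaluating the metrics *)

(** The elimination degrees on natural numbers, so that they can be computed by
    conversion; cardinals of finite sets do not reduce. *)
Definition degrees n (miss : rel nat) (r : nat -> nat) : seq nat :=
  [seq count (fun j => [&& i != j, ~~ (miss i j || miss j i) & r i < r j])
         (index_iota 0 n) | i <- index_iota 0 n].

Lemma card_ord_count n (P : pred nat) :
  #|[set w : 'I_n | P w]| = count P (index_iota 0 n).
Proof. by rewrite -sum1dep_card -(big_mkord P (fun=> 1)) sum1_count. Qed.

Lemma big_degrees n miss (r : nat -> nat) (r_lt : forall v : 'I_n, r v < #|'I_n|)
    (op : nat -> nat -> nat) idx (g : nat -> nat) :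
  \big[op/idx]_v g (elim_degree (co_graph n miss) (ordering_of r_lt) v) =
  \big[op/idx]_(d <- degrees n miss r) g d.
Proof.
rewrite /degrees big_map big_mkord.
apply: eq_bigr => v _; rewrite -card_ord_count /elim_degree higher_nbrs_of.
by congr (g _); apply: eq_card => w; rewrite !inE /= /without andbA.
Qed.

Lemma co_graph_metrics n miss (r : nat -> nat)
    (r_lt : forall v : 'I_n, r v < #|'I_n|)
    (H := co_graph n miss) (s := degrees n miss r) :
  peo H (ordering_of r_lt) ->
  [/\ nnz H = \sum_(d <- s) (d + 1), flop H = \sum_(d <- s) (d + 1) ^ 2
    & omega H = \max_(d <- s) (d + 1)].
Proof.
move=> pa; rewrite (nnz_peo pa) (flop_peo pa) (omega_peo pa).
by split; [apply: (@big_degrees _ _ _ _ _ _ (fun d => d + 1))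
  | apply: (@big_degrees _ _ _ _ _ _ (fun d => (d + 1) ^ 2))
  | apply: (@big_degrees _ _ _ _ _ _ (fun d => d + 1))].
Qed.

Definition keep_indep_degrees k a := degrees (order_of k a) (indep k) id.
Definition keep_star_degrees k a :=
  degrees (order_of k a) (star k a) (fun i => order_of k a - i.+1).

Lemma keep_indep_metrics k a (H := keep_indep k a) (s := keep_indep_degrees k a) :
  [/\ nnz H = \sum_(d <- s) (d + 1), flop H = \sum_(d <- s) (d + 1) ^ 2
    & omega H = \max_(d <- s) (d + 1)].
Proof. exact: (@co_graph_metrics _ _ id _ (keep_indep_peo k a)). Qed.

Lemma keep_star_metrics k a (H := keep_star k a) (s := keep_star_degrees k a) :
  [/\ nnz H = \sum_(d <- s) (d + 1), flop H = \sum_(d <- s) (d + 1) ^ 2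
    & omega H = \max_(d <- s) (d + 1)].
Proof.
exact: (@co_graph_metrics _ _ (fun i => order_of k a - i.+1) _ (keep_star_peo k a)).
Qed.

Lemma join_incompatible k a (mu mu' : sgraph 'I_(order_of k a) -> nat) :
    monotone mu -> monotone mu' ->
    mu (keep_star k a) < mu (keep_indep k a) ->
    mu' (keep_indep k a) < mu' (keep_star k a) ->
  ~ exists H, minimizes mu (join_graph k a) H /\ minimizes mu' (join_graph k a) H.
Proof.
move=> mon mon'; apply: no_common_minimizer mon mon' _ _ _.
- exact: triangulation_keep_indep.
- exact: triangulation_keep_star.
- exact: triangulation_dichotomy.
Qed.

Theorem theorem2p2 :
  [/\ exists (T : finType) (G : sgraph T),
        ~ exists H : sgraph T, minimizes (@nnz T) G H /\ minimizes (@flop T) G H,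
      exists (T : finType) (G : sgraph T),
        ~ exists H : sgraph T, minimizes (@nnz T) G H /\ minimizes (@omega T) G H
    & exists (T : finType) (G : sgraph T),
        ~ exists H : sgraph T, minimizes (@flop T) G H /\ minimizes (@omega T) G H].
Proof.
have indep47 : keep_indep_degrees 4 7 = [:: 8; 8; 8; 8; 7; 6; 5; 4; 3; 2; 1; 0] by [].
have star47 : keep_star_degrees 4 7 = [:: 0; 1; 2; 3; 4; 5; 6; 7; 8; 9; 10; 4] by [].
have indep34 : keep_indep_degrees 3 4 = [:: 5; 5; 5; 4; 3; 2; 1; 0] by [].
have star34 : keep_star_degrees 3 4 = [:: 0; 1; 2; 3; 4; 5; 6; 3] by [].
have [nnzI47 flopI47 _] := keep_indep_metrics 4 7.
have [nnzS47 flopS47 _] := keep_star_metrics 4 7.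
have [nnzI34 flopI34 omegaI34] := keep_indep_metrics 3 4.
have [nnzS34 flopS34 omegaS34] := keep_star_metrics 3 4.
split.
- exists 'I_(order_of 4 7), (join_graph 4 7); apply: join_incompatible.
  + exact: nnz_monotone.
  + exact: flop_monotone.
  + by rewrite nnzI47 nnzS47 indep47 star47 unlock.
  + by rewrite flopI47 flopS47 indep47 star47 unlock.
- exists 'I_(order_of 3 4), (join_graph 3 4); apply: join_incompatible.
  + exact: nnz_monotone.
  + exact: omega_monotone.
  + by rewrite nnzI34 nnzS34 indep34 star34 unlock.
  + by rewrite omegaI34 omegaS34 indep34 star34 unlock.
- exists 'I_(order_of 3 4), (join_graph 3 4); apply: join_incompatible.
  + exact: flop_monotone.
  + exact: omega_monotone.
  + by rewrite flopI34 flopS34 indep34 star34 unlock.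
  + by rewrite omegaI34 omegaS34 indep34 star34 unlock.
Qed.
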